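(* The maximum of the purity $\mathrm{tr}(\rho^2)$ over all absolutely separable two-qubit states $\rho \in M_2 \otimes M_2$ is $\frac{3}{8}$. Moreover, an absolutely separable two-qubit state $\rho$ with eigenvalues $\lambda_1 \ge \lambda_2 \ge \lambda_3 \ge \lambda_4$ (listed with multiplicity in decreasing order) attains this maximum value, i.e. $\mathrm{tr}(\rho^2) = \frac{3}{8}$, if and only if $\lambda_1 = \lambda_2 = \frac{1}{4} + \frac{1}{4\sqrt{2}}$ and $\lambda_3 = \lambda_4 = \frac{1}{4} - \frac{1}{4\sqrt{2}}$.
   Context: $M_n$ denotes the space of complex $n \times n$ matrices. A state (density matrix) is a positive semidefinite Hermitian matrix of trace $1$. A two-qubit state is a density matrix $\rho \in M_2 \otimes M_2$ (a $4\times 4$ density matrix acting on $\mathcal{H}_A \otimes \mathcal{H}_B$ with $\mathcal{H}_A = \mathcal{H}_B = \mathbb{C}^2$). The state $\rho$ is called separable if it can be written as $\rho = \sum_{i=1}^{k} p_i\, \rho_A^i \otimes \rho_B^i$ for some finite $k$, with $p_i \ge 0$, $\sum_{i=1}^k p_i = 1$, and $\rho_A^i$, $\rho_B^i$ density matrices on $\mathcal{H}_A$ and $\mathcal{H}_B$ respectively. The state $\rho$ is called absolutely separable if $U \rho U^*$ is separable for every unitary operator $U : \mathcal{H}_A \otimes \mathcal{H}_B \to \mathcal{H}_A \otimes \mathcal{H}_B$. The purity of $\rho$ is $\mathrm{tr}(\rho^2)$. *)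

(* Defs.v *)
From mathcomp Require Import all_boot all_order all_algebra.
From mathcomp Require Import reals.
From mathcomp.real_closed Require Import complex mxtens.

Set Implicit Arguments.
Unset Strict Implicit.
Unset Printing Implicit Defensive.

Import Order.TTheory GRing.Theory Num.Theory.

Local Open Scope ring_scope.
Local Open Scope complex_scope.
Local Open Scope sesquilinear_scope.

(* In R[i], [0 <= z] means that z is real and nonnegative. *)
Definition psdmx (R : realType) n (A : 'M[R[i]]_n) : Prop :=
  A \is hermsymmx /\ forall v : 'cV[R[i]]_n, 0 <= (v^t* *m A *m v) 0 0.

Definition density (R : realType) n (rho : 'M[R[i]]_n) : Prop :=
  psdmx rho /\ \tr rho = 1.

(* M_m (x) M_n is identified with M_(m * n) through the Kronecker product. *)
Definition separable (R : realType) m n (rho : 'M[R[i]]_(m * n)) : Prop :=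
  exists (k : nat) (p : 'I_k -> R)
         (rhoA : 'I_k -> 'M[R[i]]_m) (rhoB : 'I_k -> 'M[R[i]]_n),
    [/\ forall i, 0 <= p i,
        \sum_(i < k) p i = 1,
        forall i, density (rhoA i),
        forall i, density (rhoB i)
      & rho = \sum_(i < k) (p i)%:C *: (rhoA i *t rhoB i)].

Definition absolutely_separable (R : realType) m n
    (rho : 'M[R[i]]_(m * n)) : Prop :=
  density rho /\
  forall U : 'M[R[i]]_(m * n), U \is unitarymx ->
    separable (U *m rho *m U^t*).

Definition purity (R : realType) n (rho : 'M[R[i]]_n) : R[i] :=
  \tr (rho *m rho).

Definition spectrum_is (R : realType) n (rho : 'M[R[i]]_n) (s : seq R) : Prop :=
  sorted >=%R s /\ char_poly rho = \prod_(l <- s) ('X - (l%:C)%:P).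

(* Main.v *)
(* If the spectrum l1 >= l2 >= l3 >= l4 belongs to an absolutely separable state, conjugate the
   state so that its eigenvectors are |01> + |10>, |00>, |01> - |10>, |11>.  Positivity of the
   partial transpose then gives (l1 - l3)^2 <= 4 l2 l4, and with F = (l1 - l2) + (l3 - l4) < 2/3
   this yields sum l_k^2 + F (2 - 3 F) / 8 <= 3/8, with equality only when F = 0.

   For the extremal spectrum, every unitary conjugate is (1 + S / sqrt 2) / 4 with
   S = 2 P - 1 and P a projection of rank 2.  The isomorphism su(4) = so(6) turns S into a simple
   bivector u /\ v, with u = (u1, u2) and v = (v1, v2) orthonormal in R^3 + R^3; the complex
   vector u + i v is read off the 2x2 minors (Pluecker coordinates) of a basis of the range of P.
   In Pauli coordinates, S = (u1 x v1).s (x) 1 + 1 (x) (u2 x v2).s + u1.s (x) v2.s - v1.s (x) u2.s,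
   so the part depending on u1 and the part depending on u2 can be treated separately, and each
   is an average of two product states because |e x v1| <= |v1| for a unit vector e. *)

Require Import Defs.
From mathcomp Require Import all_boot all_order all_algebra.
From mathcomp Require Import perm reals ring lra.
From mathcomp.real_closed Require Import complex mxtens.

Set Implicit Arguments.
Unset Strict Implicit.
Unset Printing Implicit Defensive.

Import Order.TTheory GRing.Theory Num.Theory.

Local Open Scope ring_scope.
Local Open Scope complex_scope.
Local Open Scope sesquilinear_scope.

Local Notation Re z := (complex.Re z).
Local Notation Im z := (complex.Im z).

(** * Pauli coordinates and vectors of R^3 *)

Definition pauli (R : realType) (a : R * R * R) : 'M[R[i]]_2 :=
  let: (x, y, z) := a in
  \matrix_(i, j) if i == 0 then if j == 0 then z +i* 0 else x -i* y
                 else if j == 0 then x +i* y else (- z) +i* 0.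

Definition bloch (R : realType) (a : R * R * R) : 'M[R[i]]_2 :=
  (2^-1)%:C *: (1%:M + pauli a).

Definition sqnorm3 (R : realType) (a : R * R * R) : R :=
  let: (x, y, z) := a in x ^+ 2 + y ^+ 2 + z ^+ 2.

Definition cross (R : realType) (a b : R * R * R) : R * R * R :=
  let: (x, y, z) := a in let: (x', y', z') := b in
  (y * z' - z * y', z * x' - x * z', x * y' - y * x').

Definition scale3 (R : realType) (k : R) (a : R * R * R) : R * R * R :=
  let: (x, y, z) := a in (k * x, k * y, k * z).

Lemma complex_ext (R : realType) (z w : R[i]) : Re z = Re w -> Im z = Im w -> z = w.
Proof. by case: z w => a b [c d] /= -> ->. Qed.

(** Packed as one product so that a single [rewrite] reduces real and imaginary parts to real
    polynomials. *)
Lemma complex_reim (R : realType) :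
  ((forall z w : R[i], Re (z + w) = Re z + Re w)%R *
   (forall z w : R[i], Im (z + w) = Im z + Im w)%R *
   (forall z : R[i], Re (- z) = - Re z)%R *
   (forall z : R[i], Im (- z) = - Im z)%R *
   (forall z w : R[i], Re (z * w) = Re z * Re w - Im z * Im w)%R *
   (forall z w : R[i], Im (z * w) = Re z * Im w + Im z * Re w)%R *
   (forall z : R[i], Re (Num.conj z) = Re z)%R *
   (forall z : R[i], Im (Num.conj z) = - Im z)%R *
   (Re (0 : R[i]) = 0)%R * (Im (0 : R[i]) = 0)%R *
   (Re (1 : R[i]) = 1)%R * (Im (1 : R[i]) = 0)%R)%type.
Proof. by do ![split] => //; case=> a b; try case=> c d. Qed.

Lemma sqr_le0_eq0 (R : realType) (t : R) : t ^+ 2 <= 0 -> t = 0.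
Proof. by rewrite exprn_even_le0 // => /eqP. Qed.

(** * Separable states and the Bloch ball *)

Lemma separable_tens (R : realType) m n (A : 'M[R[i]]_m) (B : 'M[R[i]]_n) :
  density A -> density B -> separable (A *t B).
Proof.
move=> dA dB; exists 1%N, (fun=> 1), (fun=> A), (fun=> B).
by split=> //; rewrite big_ord1 ?scale1r.
Qed.

(** The two decompositions are concatenated, with weights multiplied by [t] and [1 - t]. *)
Lemma separable_convex (R : realType) m n (A B : 'M[R[i]]_(m * n)) (t : R) :
  0 <= t <= 1 -> separable A -> separable B ->
  separable (t%:C *: A + (1 - t)%:C *: B).
Proof.
move=> /andP[t0 t1] [k [p [a [b [p0 p1 da db ->]]]]].
move=> [k' [p' [a' [b' [p0' p1' da' db' ->]]]]].
pose glue (T : Type) (f : 'I_k -> T) (g : 'I_k' -> T) i :=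
  match split i with inl j => f j | inr j => g j end.
have glueL (T : Type) (f : 'I_k -> T) g j : glue T f g (lshift k' j) = f j.
  by rewrite /glue (unsplitK (inl j)).
have glueR (T : Type) f (g : 'I_k' -> T) j : glue T f g (rshift k j) = g j.
  by rewrite /glue (unsplitK (inr j)).
exists (k + k')%N, (glue R (fun j => t * p j) (fun j => (1 - t) * p' j)),
  (glue _ a a'), (glue _ b b').
split.
- by move=> i; rewrite /glue; case: split => j; rewrite mulr_ge0 // subr_ge0.
- rewrite big_split_ord /=; under eq_bigr do rewrite glueL.
  under [X in _ + X]eq_bigr do rewrite glueR.
  by rewrite -!mulr_sumr p1 p1' !mulr1 addrC subrK.
- by move=> i; rewrite /glue; case: split.
- by move=> i; rewrite /glue; case: split.
- rewrite big_split_ord !scaler_sumr /=; congr (_ + _); apply: eq_bigr => i _.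
    by rewrite !glueL scalerA -rmorphM.
  by rewrite !glueR scalerA -rmorphM.
Qed.

(** On a vector of squared norm N, twice the quadratic form is N + a . d with |d| = N; this is
    nonnegative by Cauchy-Schwarz, used below as a completed square. *)
Lemma bloch_density (R : realType) (a : R * R * R) :
  sqnorm3 a <= 1 -> density (bloch a).
Proof.
case: a => [[x y] z] /= n1; split; last first.
  rewrite /mxtrace !big_ord_recl big_ord0 !mxE /=.
  by apply: complex_ext; rewrite !complex_reim /=; field.
split.
  apply/is_hermitianmxP; rewrite expr0 scale1r.
  apply/matrixP => i j; rewrite !mxE.
  case: i => [[|[|//]] hi]; case: j => [[|[|//]] hj] /=;
  by apply: complex_ext; rewrite !complex_reim /=; ring.
move=> v; rewrite mxE !big_ord_recl big_ord0 !mxE !big_ord_recl !big_ord0 !mxE /=.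
set p := v ord0 0; set q := v _ 0.
case: p => p1 p2; case: q => q1 q2.
rewrite lecE; apply/andP; split.
  by apply/eqP; rewrite !complex_reim /=; ring.
rewrite !complex_reim /=.
set r := (X in 0 <= X).
pose N := p1 ^+ 2 + p2 ^+ 2 + (q1 ^+ 2 + q2 ^+ 2).
(* The vector d is the image of (p, q) under the Hopf map: dx + i dy = 2 conj(p) q and dz = |p|^2 -
   |q|^2. *)
pose dx := 2 * (p1 * q1 + p2 * q2).
pose dy := 2 * (p1 * q2 - p2 * q1).
pose dz := p1 ^+ 2 + p2 ^+ 2 - (q1 ^+ 2 + q2 ^+ 2).
have rE : 2 * r = N + x * dx + y * dy + z * dz.
  by rewrite /r /N /dx /dy /dz; field.
have dN : dx ^+ 2 + dy ^+ 2 + dz ^+ 2 = N ^+ 2.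
  by rewrite /N /dx /dy /dz; ring.
have NrE : 4 * N * r = (dx + N * x) ^+ 2 + (dy + N * y) ^+ 2 + (dz + N * z) ^+ 2
    + N ^+ 2 * (1 - (x ^+ 2 + y ^+ 2 + z ^+ 2)).
  transitivity (dx ^+ 2 + dy ^+ 2 + dz ^+ 2 + N ^+ 2
      + 2 * N * (x * dx + y * dy + z * dz)); last by ring.
  rewrite dN (_ : 4 * N * r = 2 * N * (2 * r)); last by ring.
  by rewrite rE; ring.
have Nr_ge0 : 0 <= N * r.
  have := mulr_ge0 (sqr_ge0 N) (_ : 0 <= 1 - (x ^+ 2 + y ^+ 2 + z ^+ 2)).
  rewrite subr_ge0 => /(_ n1); have := sqr_ge0 (dx + N * x).
  by have := sqr_ge0 (dy + N * y); have := sqr_ge0 (dz + N * z); lra.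
have N_ge0 : 0 <= N by rewrite /N !addr_ge0 ?sqr_ge0.
(* For N > 0 the factor N cancels; for N = 0 the vector is zero and the form vanishes. *)
have [N0|N0] := eqVneq N 0; last first.
  by rewrite -(pmulr_rge0 _ (_ : 0 < N)) // lt_def N0.
have := sqr_ge0 p1; have := sqr_ge0 p2; have := sqr_ge0 q1; have := sqr_ge0 q2.
move: N0; rewrite /N => N0 h1 h2 h3 h4.
have p10 : p1 = 0 by apply: sqr_le0_eq0; lra.
have p20 : p2 = 0 by apply: sqr_le0_eq0; lra.
have q10 : q1 = 0 by apply: sqr_le0_eq0; lra.
have q20 : q2 = 0 by apply: sqr_le0_eq0; lra.
by rewrite /r p10 p20 q10 q20; lra.
Qed.

(** * Inequalities between the eigenvalues *)

(** Put a = l1 + l3 and b = l2 + l4, so that a + b = 1 and F = a - b. The left side minus 3/8 is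
    then exactly half of (l1 - l3)^2 - 4 l2 l4. *)
Lemma sqr_sum_add_gap_le (R : realType) (l1 l2 l3 l4 : R) :
  l1 + l2 + l3 + l4 = 1 -> (l1 - l3) ^+ 2 <= 4 * l2 * l4 ->
  l1 ^+ 2 + l2 ^+ 2 + l3 ^+ 2 + l4 ^+ 2
    + (l1 - l2 + (l3 - l4)) * (2 - 3 * (l1 - l2 + (l3 - l4))) / 8 <= 3 / 8.
Proof.
move=> sum1 hc.
have e4 : l4 = 1 - l1 - l2 - l3 by lra.
by rewrite e4 in hc *; lra.
Qed.

(** Since 4 l2 l4 <= (l2 + l4)^2, the quadratic hypothesis yields l1 - l3 <= l2 + l4, and the rest
    is linear. The bound makes the factor 2 - 3 F positive. *)
Lemma gap_lt (R : realType) (l1 l2 l3 l4 : R) :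
  l2 <= l1 -> l3 <= l2 -> l4 <= l3 -> 0 <= l4 -> l1 + l2 + l3 + l4 = 1 ->
  (l1 - l3) ^+ 2 <= 4 * l2 * l4 ->
  (l1 - l2) + (l3 - l4) < 2 / 3.
Proof.
move=> h21 h32 h43 h4 sum1 hc.
have : l1 - l3 <= l2 + l4.
  rewrite -(@ler_pXn2r _ 2) ?nnegrE //; [|lra|lra].
  have : 0 <= (l2 - l4) ^+ 2 by apply: sqr_ge0.
  by lra.
by lra.
Qed.

Lemma sqr_sum_le (R : realType) (l1 l2 l3 l4 : R) :
  l2 <= l1 -> l3 <= l2 -> l4 <= l3 -> 0 <= l4 -> l1 + l2 + l3 + l4 = 1 ->
  (l1 - l3) ^+ 2 <= 4 * l2 * l4 ->
  l1 ^+ 2 + l2 ^+ 2 + l3 ^+ 2 + l4 ^+ 2 <= 3 / 8 /\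
  (l1 ^+ 2 + l2 ^+ 2 + l3 ^+ 2 + l4 ^+ 2 = 3 / 8 ->
    [/\ l1 = 1 / 4 + 1 / (4 * Num.sqrt 2),
        l2 = 1 / 4 + 1 / (4 * Num.sqrt 2),
        l3 = 1 / 4 - 1 / (4 * Num.sqrt 2)
      & l4 = 1 / 4 - 1 / (4 * Num.sqrt 2)]).
Proof.
move=> h21 h32 h43 h4 sum1 hc.
have := sqr_sum_add_gap_le sum1 hc; have := gap_lt h21 h32 h43 h4 sum1 hc.
set F := _ + (_ - _) => F_lt /= bound.
have F_ge0 : 0 <= F by rewrite /F; lra.
have FF_ge0 : 0 <= F * (2 - 3 * F) by rewrite mulr_ge0 //; lra.
split=> [|eqp]; first by lra.
have F0 : F = 0.
  apply/eqP; rewrite -[_ == _]orbF.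
  have <- : (2 - 3 * F == 0) = false by apply/negbTE; rewrite gt_eqF //; lra.
  by rewrite -mulf_eq0 eq_le FF_ge0 andbT; lra.
(* Both summands l1 - l2 and l3 - l4 of F are nonnegative, so each is zero. *)
have e2 : l2 = l1 by rewrite /F in F0; lra.
have e3 : l3 = 2^-1 - l1 by rewrite /F in F0; lra.
have e4 : l4 = 2^-1 - l1 by rewrite /F in F0; lra.
have s2_gt0 : 0 < Num.sqrt 2 :> R by rewrite sqrtr_gt0.
have l1E : l1 = 1 / 4 + 1 / (4 * Num.sqrt 2).
  suff : l1 - 1 / 4 = 1 / (4 * Num.sqrt 2) by lra.
  (* The purity equation becomes (l1 - 1/4)^2 = 1/32, and l1 >= 1/4 selects the positive root. *)
  apply/eqP; rewrite -(@eqrXn2 _ 2) //; [|lra|by rewrite divr_ge0 // mulr_ge0 // ltW].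
  rewrite expr_div_n expr1n exprMn sqr_sqrtr //.
  by rewrite e2 e3 e4 in eqp; apply/eqP; lra.
by split; lra.
Qed.

(** * Separability of bivector states *)

Lemma sqnorm3_ge0 (R : realType) (a : R * R * R) : 0 <= sqnorm3 a.
Proof. by case: a => [[x y] z]; rewrite /= !addr_ge0 ?sqr_ge0. Qed.

Lemma sqnorm3_scale (R : realType) (k : R) (a : R * R * R) :
  sqnorm3 (scale3 k a) = k ^+ 2 * sqnorm3 a.
Proof. by case: a => [[x y] z] /=; ring. Qed.

Definition add3 (R : realType) (a b : R * R * R) : R * R * R :=
  let: (x, y, z) := a in let: (x', y', z') := b in (x + x', y + y', z + z').

(** The vectors e x v and k e are orthogonal, and |e x v|^2 = |e|^2 |v|^2 - (e . v)^2. *)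
Lemma sqnorm3_cross_add_scale (R : realType) (k : R) (e v : R * R * R) :
  sqnorm3 e <= 1 ->
  sqnorm3 (add3 (cross e v) (scale3 k e)) <= sqnorm3 v + k ^+ 2.
Proof.
case: e v => [[e1 e2] e3] [[v1 v2] v3] /= he.
have hv : 0 <= v1 ^+ 2 + v2 ^+ 2 + v3 ^+ 2 + k ^+ 2.
  by rewrite !addr_ge0 ?sqr_ge0.
have := ler_wpM2r hv he; have := sqr_ge0 (e1 * v1 + e2 * v2 + e3 * v3).
by lra.
Qed.

Lemma scale3_unit_ball (R : realType) (k : R) (w : R * R * R) :
  sqnorm3 w <= k ^+ 2 -> exists2 d, sqnorm3 d <= 1 & w = scale3 k d.
Proof.
have [->|k0] := eqVneq k 0; last first.
  move=> hw; exists (scale3 k^-1 w).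
    by rewrite sqnorm3_scale exprVn mulrC ler_pdivrMr ?mul1r // exprn_even_gt0.
  by case: (w) => [[x y] z] /=; congr (_, _, _); field.
case: w => [[x y] z] /= s0; exists (0, 0, 0) => /=; first by lra.
have := sqr_ge0 x; have := sqr_ge0 y; have := sqr_ge0 z => hz hy hx.
by congr (_, _, _); rewrite mul0r; apply: sqr_le0_eq0; lra.
Qed.

Lemma pauliD (R : realType) (a b : R * R * R) :
  pauli (add3 a b) = pauli a + pauli b.
Proof.
case: a b => [[a1 a2] a3] [[b1 b2] b3]; apply/matrixP => i j; rewrite !mxE.
by case: ifP => _; case: ifP => _; apply: complex_ext; rewrite !complex_reim /=; ring.
Qed.

Lemma pauliZ (R : realType) (k : R) (a : R * R * R) :
  pauli (scale3 k a) = k%:C *: pauli a.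
Proof.
case: a => [[a1 a2] a3]; apply/matrixP => i j; rewrite !mxE.
by case: ifP => _; case: ifP => _; apply: complex_ext; rewrite !complex_reim /=; ring.
Qed.

Lemma cross_scalel (R : realType) (k : R) (a b : R * R * R) :
  cross (scale3 k a) b = scale3 k (cross a b).
Proof. by case: a b => [[a1 a2] a3] [[b1 b2] b3] /=; congr (_, _, _); ring. Qed.

Lemma real_complex_frac (R : realType) (n : nat) : (n%:R^-1)%:C = n%:R^-1 :> R[i].
Proof. by rewrite fmorphV rmorph_nat. Qed.

(* Averaging over a common sign kills the marginal on the second factor. *)
Lemma average_bloch_l (R : realType) (p e d : R * R * R) (k : R) :
  (2^-1)%:C *: (bloch (add3 p (scale3 k e)) *t bloch d)
    + (1 - 2^-1)%:C *: (bloch (add3 p (scale3 (- k) e)) *t bloch (scale3 (-1) d))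
  = (4^-1)%:C *: (1%:M *t 1%:M + pauli p *t 1%:M + pauli e *t pauli (scale3 k d)).
Proof.
rewrite /bloch !(pauliD, pauliZ) (rmorphB _ 1) !rmorphN rmorph1 /= !real_complex_frac.
move: (pauli p) (pauli e) (pauli d) k%:C => P E D c; apply/matrixP => i j.
rewrite !mxE; case: (mxtens_unindex i) (mxtens_unindex j) => [i1 i2] [j1 j2] /=.
move: (_ *+ (i1 == j1)) (_ *+ (i2 == j2)) => u v.
move: (P _ _) (E _ _) (D _ _) => {}P {}E {}D.
by field.
Qed.

Lemma average_bloch_r (R : realType) (p e d : R * R * R) (k : R) :
  (2^-1)%:C *: (bloch d *t bloch (add3 p (scale3 k e)))
    + (1 - 2^-1)%:C *: (bloch (scale3 (-1) d) *t bloch (add3 p (scale3 (- k) e)))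
  = (4^-1)%:C *: (1%:M *t 1%:M + 1%:M *t pauli p + pauli (scale3 k d) *t pauli e).
Proof.
rewrite /bloch !(pauliD, pauliZ) (rmorphB _ 1) !rmorphN rmorph1 /= !real_complex_frac.
move: (pauli p) (pauli e) (pauli d) k%:C => P E D c; apply/matrixP => i j.
rewrite !mxE; case: (mxtens_unindex i) (mxtens_unindex j) => [i1 i2] [j1 j2] /=.
move: (_ *+ (i1 == j1)) (_ *+ (i2 == j2)) => u v.
move: (P _ _) (E _ _) (D _ _) => {}P {}E {}D.
by field.
Qed.

(** Write w = k d with k = |w| and |d| <= 1. The state is the average of the two product states with
    Bloch vectors e x v + k e, d and e x v - k e, -d; the first vectors stay in the unit ball
    because |v|^2 + k^2 <= 1. *)
Lemma separable_half_l (R : realType) (e v w : R * R * R) :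
  sqnorm3 e <= 1 -> sqnorm3 v + sqnorm3 w <= 1 ->
  @separable R 2 2
    ((4^-1)%:C *: (1%:M *t 1%:M + pauli (cross e v) *t 1%:M + pauli e *t pauli w)).
Proof.
move=> he hvw; pose k := Num.sqrt (sqnorm3 w).
have k2 : k ^+ 2 = sqnorm3 w by rewrite sqr_sqrtr ?sqnorm3_ge0.
have [|d hd ->] := @scale3_unit_ball _ k w; first by rewrite k2.
rewrite -average_bloch_l; apply: separable_convex; first by lra.
  apply: separable_tens; apply: bloch_density => //.
  by apply: le_trans (sqnorm3_cross_add_scale _ _ he) _; rewrite k2.
apply: separable_tens; apply: bloch_density; last first.
  by rewrite sqnorm3_scale sqrrN expr1n mul1r.
by apply: le_trans (sqnorm3_cross_add_scale _ _ he) _; rewrite sqrrN k2.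
Qed.

Lemma separable_half_r (R : realType) (e v w : R * R * R) :
  sqnorm3 e <= 1 -> sqnorm3 v + sqnorm3 w <= 1 ->
  @separable R 2 2
    ((4^-1)%:C *: (1%:M *t 1%:M + 1%:M *t pauli (cross e v) + pauli w *t pauli e)).
Proof.
move=> he hvw; pose k := Num.sqrt (sqnorm3 w).
have k2 : k ^+ 2 = sqnorm3 w by rewrite sqr_sqrtr ?sqnorm3_ge0.
have [|d hd ->] := @scale3_unit_ball _ k w; first by rewrite k2.
rewrite -average_bloch_r; apply: separable_convex; first by lra.
  apply: separable_tens; apply: bloch_density => //.
  by apply: le_trans (sqnorm3_cross_add_scale _ _ he) _; rewrite k2.
apply: separable_tens; apply: bloch_density.
  by rewrite sqnorm3_scale sqrrN expr1n mul1r.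
by apply: le_trans (sqnorm3_cross_add_scale _ _ he) _; rewrite sqrrN k2.
Qed.

Definition bivector_mx (R : realType) (u1 u2 v1 v2 : R * R * R) : 'M[R[i]]_(2 * 2) :=
  pauli (cross u1 v1) *t 1%:M + 1%:M *t pauli (cross u2 v2)
  + pauli u1 *t pauli v2 - pauli v1 *t pauli u2.

(** The matrix is linear in (u1, u2). The bound 1/2 forces |u1| + |u2| <= 1, so with w = |u1| the
    state is a mixture, with weights w and 1 - w, of one state involving only the direction of u1
    and one involving only that of u2. *)
Lemma separable_bivector (R : realType) (u1 u2 v1 v2 : R * R * R) :
  sqnorm3 u1 + sqnorm3 u2 <= 2^-1 -> sqnorm3 v1 + sqnorm3 v2 <= 1 ->
  @separable R 2 2 ((4^-1)%:C *: (1%:M *t 1%:M + bivector_mx u1 u2 v1 v2)).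
Proof.
move=> hu hv; pose w := Num.sqrt (sqnorm3 u1).
have w2 : w ^+ 2 = sqnorm3 u1 by rewrite sqr_sqrtr ?sqnorm3_ge0.
have w0 : 0 <= w by apply: sqrtr_ge0.
have [|e1 he1 u1E] := @scale3_unit_ball _ w u1; first by rewrite w2.
have [|e2 he2 u2E] := @scale3_unit_ball _ (1 - w) u2.
  (* Indeed (1 - w)^2 - (1/2 - w^2) = 2 (w - 1/2)^2. *)
  by have := sqr_ge0 (w - 2^-1); lra.
have w1 : w <= 1.
  rewrite -(@ler_pXn2r _ 2) ?nnegrE // w2 expr1n.
  by have := sqnorm3_ge0 u2; lra.
have hl : sqnorm3 v1 + sqnorm3 v2 <= 1 by [].
have hr : sqnorm3 v2 + sqnorm3 (scale3 (-1) v1) <= 1.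
  by rewrite sqnorm3_scale sqrrN expr1n mul1r addrC.
have w01 : 0 <= w <= 1 by rewrite w0.
have := separable_convex w01 (separable_half_l he1 hl) (separable_half_r he2 hr).
congr separable; rewrite /bivector_mx u1E u2E !cross_scalel !pauliZ.
rewrite (rmorphB _ 1) rmorphN rmorph1 /= !real_complex_frac.
move: (pauli (cross e1 v1)) (pauli (cross e2 v2)) => X1 X2.
move: (pauli e1) (pauli e2) (pauli v1) (pauli v2) w%:C.
move=> E1 E2 V1 V2 c; apply/matrixP => i j.
rewrite !mxE; case: (mxtens_unindex i) (mxtens_unindex j) => [i1 i2] [j1 j2] /=.
move: (_ *+ (i1 == j1)) (_ *+ (i2 == j2)) => u v.
move: (E1 _ _) (E2 _ _) (V1 _ _) (V2 _ _) (X1 _ _) (X2 _ _).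
by move=> {}E1 {}E2 {}V1 {}V2 {}X1 {}X2; field.
Qed.

(** * Rank-two projections as bivectors *)

(* Hiding the imaginary unit keeps [rewrite] from unfolding it in turn. *)
Lemma imaginary_unit_rect (R : realType) : exists I : R[i],
  [/\ I ^+ 2 = -1, forall a b : R, a +i* b = a%:C + I * b%:C
    & forall a b : R, Num.conj (a +i* b) = a%:C - I * b%:C].
Proof.
exists 'i; split=> [|a b|a b]; apply: complex_ext; rewrite ?expr2 !complex_reim /=; ring.
Qed.

(* The coordinates come from the splitting of the skew part of C^4 (x) C^4, C^4 = C^2 (x) C^2, into
   Sym^2 (x) Alt^2 and Alt^2 (x) Sym^2, both isomorphic to C^3 via the Pauli matrices; the second
   summand is multiplied by i so that the Pluecker relation becomes a sum of squares. *)
Lemma skew_gram_bivector (R : realType) (M : 'M[R[i]]_(2 * 2)) :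
  M^T = - M ->
  let m i j := M (@inord 3 i) (@inord 3 j) in
  2 *: (M *m M^t*) =
  (m 0%N 1%N * Num.conj (m 0%N 1%N) + m 0%N 2%N * Num.conj (m 0%N 2%N)
   + m 0%N 3%N * Num.conj (m 0%N 3%N) + m 1%N 2%N * Num.conj (m 1%N 2%N)
   + m 1%N 3%N * Num.conj (m 1%N 3%N) + m 2%N 3%N * Num.conj (m 2%N 3%N))
    *: (1%:M *t 1%:M) +
  bivector_mx
    (Re (m 2%N 3%N - m 0%N 1%N), Im (m 0%N 1%N + m 2%N 3%N), Re (m 0%N 3%N - m 1%N 2%N))
    (Im (m 0%N 2%N - m 1%N 3%N), Re (m 0%N 2%N + m 1%N 3%N), - Im (m 0%N 3%N + m 1%N 2%N))
    (Im (m 2%N 3%N - m 0%N 1%N), - Re (m 0%N 1%N + m 2%N 3%N), Im (m 0%N 3%N - m 1%N 2%N))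
    (Re (m 1%N 3%N - m 0%N 2%N), Im (m 0%N 2%N + m 1%N 3%N), Re (m 0%N 3%N + m 1%N 2%N)).
Proof.
move=> skew m; have [I [sqrI rectE conjE]] := imaginary_unit_rect R.
have mE (i j : 'I_4) : M i j = m i j by rewrite /m !inord_val.
have mC i j : m j i = - m i j by have /matrixP/(_ (inord i) (inord j)) := skew; rewrite !mxE.
have m0 i : m i i = 0.
  have /eqP : m i i *+ 2 = 0 by rewrite mulr2n {1}mC addNr.
  by rewrite mulrn_eq0 => /eqP.
rewrite !complex_reim; apply/matrixP => i j; rewrite ![in LHS]mxE !big_ord_recl big_ord0.
rewrite ![in LHS]mxE !mE !lift0.
case: i => [[|[|[|[|//]]]] hi]; case: j => [[|[|[|[|//]]]] hj] /=.
all: rewrite ?m0 ?(mC 0%N 1%N) ?(mC 0%N 2%N) ?(mC 0%N 3%N).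
all: rewrite ?(mC 1%N 2%N) ?(mC 1%N 3%N) ?(mC 2%N 3%N).
all: rewrite ?rmorphN ?rmorph0 !mxE /=; clearbody m.
all: move: (m 0%N 1%N) (m 0%N 2%N) (m 0%N 3%N) (m 1%N 2%N) (m 1%N 3%N) (m 2%N 3%N).
all: move=> [p01 q01] [p02 q02] [p03 q03] [p12 q12] [p13 q13] [p23 q23] /=.
all: rewrite !conjE !rectE.
all: by ring: sqrI.
Qed.

(** Each of the six independent entries occurs twice up to sign. This identifies the coefficient of
    the identity in [skew_gram_bivector] as half the trace. *)
Lemma skew_gram_trace (R : realType) (M : 'M[R[i]]_(2 * 2)) :
  M^T = - M ->
  let m i j := M (@inord 3 i) (@inord 3 j) in
  \tr (M *m M^t*) =
  2 * (m 0%N 1%N * Num.conj (m 0%N 1%N) + m 0%N 2%N * Num.conj (m 0%N 2%N)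
   + m 0%N 3%N * Num.conj (m 0%N 3%N) + m 1%N 2%N * Num.conj (m 1%N 2%N)
   + m 1%N 3%N * Num.conj (m 1%N 3%N) + m 2%N 3%N * Num.conj (m 2%N 3%N)).
Proof.
move=> skew m.
have mE (i j : 'I_4) : M i j = m i j by rewrite /m !inord_val.
have mC i j : m j i = - m i j by have /matrixP/(_ (inord i) (inord j)) := skew; rewrite !mxE.
have m0 i : m i i = 0.
  have /eqP : m i i *+ 2 = 0 by rewrite mulr2n {1}mC addNr.
  by rewrite mulrn_eq0 => /eqP.
rewrite /mxtrace !big_ord_recl big_ord0 !mxE !big_ord_recl !big_ord0 !mxE !mE !lift0 /=.
rewrite !m0 ?(mC 0%N 1%N) ?(mC 0%N 2%N) ?(mC 0%N 3%N) ?(mC 1%N 2%N) ?(mC 1%N 3%N) ?(mC 2%N 3%N).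
rewrite !rmorphN rmorph0 /=.
move: (m 0%N 1%N) (m 0%N 2%N) (m 0%N 3%N) (m 1%N 2%N) (m 1%N 3%N) (m 2%N 3%N).
move=> m01 m02 m03 m12 m13 m23.
move: (Num.conj m01) (Num.conj m02) (Num.conj m03) (Num.conj m12) (Num.conj m13) (Num.conj m23).
by move=> *; ring.
Qed.

Lemma bivector_mx_scale (R : realType) (k : R) (u1 u2 v1 v2 : R * R * R) :
  bivector_mx (scale3 k u1) (scale3 k u2) v1 v2 = k%:C *: bivector_mx u1 u2 v1 v2.
Proof.
rewrite /bivector_mx !cross_scalel !pauliZ.
move: (pauli (cross u1 v1)) (pauli (cross u2 v2)) => X1 X2.
move: (pauli u1) (pauli u2) (pauli v1) (pauli v2) k%:C => U1 U2 V1 V2 c.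
apply/matrixP => i j.
rewrite !mxE; case: (mxtens_unindex i) (mxtens_unindex j) => [i1 i2] [j1 j2] /=.
move: (_ *+ (i1 == j1)) (_ *+ (i2 == j2)) => u v.
move: (U1 _ _) (U2 _ _) (V1 _ _) (V2 _ _) (X1 _ _) (X2 _ _).
by move=> {}U1 {}U2 {}V1 {}V2 {}X1 {}X2; ring.
Qed.

(* The projection onto an orthonormal pair is the Gram matrix of its 2x2 minors. *)
Lemma gram_minors (C : numClosedFieldType) n (x y : 'I_n -> C) :
  \sum_k x k * Num.conj (x k) = 1 -> \sum_k y k * Num.conj (y k) = 1 ->
  \sum_k x k * Num.conj (y k) = 0 -> \sum_k y k * Num.conj (x k) = 0 ->
  let M := \matrix_(i, j) (x i * y j - x j * y i) in
  M *m M^t* = \matrix_(i, j) (x i * Num.conj (x j) + y i * Num.conj (y j)).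
Proof.
move=> xx yy xy yx M; apply/matrixP => i j; rewrite !mxE.
transitivity (x i * Num.conj (x j) * (\sum_k y k * Num.conj (y k))
  - x i * Num.conj (y j) * (\sum_k y k * Num.conj (x k))
  - y i * Num.conj (x j) * (\sum_k x k * Num.conj (y k))
  + y i * Num.conj (y j) * (\sum_k x k * Num.conj (x k))); last first.
  by rewrite xx yy xy yx !mulr1 !mulr0 !subr0.
rewrite !mulr_sumr -!sumrB -big_split /=; apply: eq_bigr => k _.
rewrite !mxE rmorphB !rmorphM /=.
by move: (Num.conj _) (Num.conj (y j)) => *; ring.
Qed.

Lemma minors_skew (C : comNzRingType) n (x y : 'I_n -> C) :
  let M := \matrix_(i, j) (x i * y j - x j * y i) in M^T = - M.
Proof. by apply/matrixP => i j; rewrite !mxE opprB. Qed.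

Lemma minors_pluecker (C : comNzRingType) n (x y : 'I_n -> C) (i j k l : 'I_n) :
  let M := \matrix_(i, j) (x i * y j - x j * y i) in
  M i j * M k l - M i k * M j l + M i l * M j k = 0.
Proof. by rewrite /= !mxE; ring. Qed.

Lemma tens_mx1 (R : nzRingType) m n : (1%:M : 'M[R]_m) *t (1%:M : 'M[R]_n) = 1%:M.
Proof.
apply/matrixP => i j; rewrite !mxE -(can_eq (@mxtens_unindexK m n)).
by rewrite -natrM mulnb -xpair_eqE -!surjective_pairing.
Qed.

(** With P the projection onto the span of x and y, the state is (1 + r (2 P - 1)) / 4, and 2 P - 1
    is the bivector of unit vectors u and v. Moving r onto u gives it squared norm 1/2, the bound of
    [separable_bivector]. *)
Lemma separable_rank2_mixture (R : realType) (x y : 'I_4 -> R[i]) :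
  \sum_k x k * Num.conj (x k) = 1 -> \sum_k y k * Num.conj (y k) = 1 ->
  \sum_k x k * Num.conj (y k) = 0 -> \sum_k y k * Num.conj (x k) = 0 ->
  let r : R := (Num.sqrt 2)^-1 in
  @separable R 2 2 (((1 - r) / 4)%:C *: 1%:M +
    (r / 2)%:C *: \matrix_(i, j) (x i * Num.conj (x j) + y i * Num.conj (y j))).
Proof.
move=> xx yy xy yx r.
have r2 : r ^+ 2 = 2^-1 by rewrite exprVn sqr_sqrtr.
rewrite -gram_minors //; set M := \matrix_(i, j) _.
have skew : M^T = - M by apply: minors_skew.
have := skew_gram_trace skew.
have := skew_gram_bivector skew.
have := minors_pluecker x y (inord 0) (inord 1) (inord 2) (inord 3); rewrite /= -/M.
have -> : \tr (M *m M^t*) = 2.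
  rewrite gram_minors //; rewrite /mxtrace; under eq_bigr do rewrite mxE.
  by rewrite big_split /= xx yy.
set m01 := M (inord 0) (inord 1); set m23 := M (inord 2) (inord 3).
set m02 := M (inord 0) (inord 2); set m13 := M (inord 1) (inord 3).
set m03 := M (inord 0) (inord 3); set m12 := M (inord 1) (inord 2).
move=> pluecker gramE two_eq.
set N := (X in _ = X *: _ + _) in gramE.
have N1 : N = 1.
  apply: (@mulfI _ 2); first by rewrite pnatr_eq0.
  by rewrite mulr1; apply: esym two_eq.
have GE : M *m M^t* = 2^-1 *: (2 *: (M *m M^t*)).
  by rewrite scalerA mulVf ?pnatr_eq0 // scale1r.
rewrite GE gramE N1 scale1r -(@tens_mx1 _ 2 2).
set u1 := (X in bivector_mx X _ _ _); set u2 := (X in bivector_mx _ X _ _).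
set v1 := (X in bivector_mx _ _ X _); set v2 := (X in bivector_mx _ _ _ X).
suff : @separable R 2 2 ((4^-1)%:C *:
    (1%:M *t 1%:M + bivector_mx (scale3 r u1) (scale3 r u2) v1 v2)).
  congr separable; rewrite bivector_mx_scale.
  rewrite !rmorphM !rmorphB rmorph1 /= !real_complex_frac scalerA.
  move: (1%:M *t 1%:M) (bivector_mx _ _ _ _) r%:C => I B c.
  by apply/matrixP => i j; rewrite !mxE; move: (I i j) (B i j) => {}I {}B; field.
(* The sum of the squared coordinates of u + i v is -4 times the Pluecker expression, so |u|^2 =
   |v|^2, while |u|^2 + |v|^2 = 2 N = 2. *)
suff [hu hv] : sqnorm3 u1 + sqnorm3 u2 = 1 /\ sqnorm3 v1 + sqnorm3 v2 = 1.
  apply: separable_bivector; last by rewrite hv.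
  by rewrite !sqnorm3_scale r2 -mulrDr hu mulr1.
have {N1} : Re N = 1 by rewrite N1.
have : Re (m01 * m23 - m02 * m13 + m03 * m12) = 0 by rewrite pluecker.
rewrite /N {N gramE two_eq GE pluecker} /u1 /u2 /v1 /v2 {u1 u2 v1 v2} !complex_reim.
move: m01 m23 m02 m13 m03 m12.
move=> [p01 q01] [p23 q23] [p02 q02] [p13 q13] [p03 q03] [p12 q12] /= pluecker norm1.
by split; lra.
Qed.

(** * Unitary diagonalization and the ordered spectrum *)

Lemma mulmx_adj_unitary (C : numClosedFieldType) n (W : 'M[C]_n) :
  W \is unitarymx -> W^t* *m W = 1%:M.
Proof. by move=> Wu; rewrite -invmx_unitary // mulVmx // unitarymx_unit. Qed.

(* Any two unitary eigenbases are exchanged by a unitary conjugation. *)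
Lemma unitary_change_basis (C : numClosedFieldType) n (V W D : 'M[C]_n) :
  V \is unitarymx -> W \is unitarymx ->
  exists2 U : 'M[C]_n, U \is unitarymx & U *m (W *m D *m W^t*) *m U^t* = V *m D *m V^t*.
Proof.
move=> Vu Wu; exists (V *m W^t*); first by rewrite mul_unitarymx // trmxC_unitary.
rewrite trmx_mul map_mxM trmxCK !mulmxA -(mulmxA V (W^t*) W) mulmx_adj_unitary // mulmx1.
by rewrite -(mulmxA _ (W^t*) W) mulmx_adj_unitary // mulmx1.
Qed.

Lemma char_poly_conj (F : fieldType) n (P D : 'M[F]_n) :
  P \in unitmx -> char_poly (invmx P *m D *m P) = char_poly D.
Proof.
move=> Pu; rewrite /char_poly.
have -> : char_poly_mx (invmx P *m D *m P) =
    map_mx polyC (invmx P) *m char_poly_mx D *m map_mx polyC P.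
  rewrite /char_poly_mx mulmxBr mulmxBl scalar_mxC -(mulmxA 'X%:M) -!map_mxM.
  by rewrite mulVmx // map_mx1 mulmx1.
rewrite !det_mulmx mulrC mulrA -det_mulmx -map_mxM mulmxV // map_mx1 det1.
by rewrite mul1r.
Qed.

Lemma hermitian_diagonalization (R : realType) n (A : 'M[R[i]]_n) :
  A \is hermsymmx ->
  exists (P : 'M[R[i]]_n) (d : 'I_n -> R),
    [/\ P \is unitarymx, A = P^t* *m diag_mx (\row_(k < n) (d k)%:C) *m P
    & char_poly A = \prod_k ('X - ((d k)%:C)%:P)].
Proof.
move=> hA; have := hermitian_spectral_diag_real hA.
have /orthomx_spectralP := hermitian_normalmx hA.
move: (spectral_diag A) (spectral_unitarymx A) (spectral_unit A).
move: (spectralmx A) => P D Pu Pinv AE /mxOverP Dreal.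
have DE : D = \row_k (Re (D 0 k))%:C.
  by apply/rowP => k; rewrite mxE RRe_real.
exists P, (fun k => Re (D 0 k)); split=> //; first by rewrite -DE -invmx_unitary.
rewrite AE char_poly_conj // char_poly_trig ?diag_mx_is_trig //.
by apply: eq_bigr => k _; rewrite mxE eqxx mulr1n {1}DE mxE.
Qed.

Lemma hermitian_spectrum (R : realType) n (A : 'M[R[i]]_n) :
  A \is hermsymmx -> exists s : n.-tuple R, spectrum_is A s.
Proof.
move=> /hermitian_diagonalization [P [d [_ _ cA]]].
pose s := sort >=%R (codom d).
have szs : size s == n by rewrite size_sort size_codom card_ord.
exists (Tuple szs); split.
  by apply: sort_sorted => x y; rewrite orbC; apply: le_total.
rewrite cA -(big_map d xpredT (fun l => 'X - (l%:C)%:P)).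
by apply: perm_big; rewrite perm_sym perm_sort codomE enumT.
Qed.

(** The two factorizations of the characteristic polynomial have the same roots up to order, so
    permuting the eigenvectors puts the eigenvalues in the order of [s]. *)
Lemma unitary_diag_of_spectrum (R : realType) n (A : 'M[R[i]]_n) (s : seq R) :
  A \is hermsymmx -> spectrum_is A s ->
  exists2 W : 'M[R[i]]_n, W \is unitarymx &
    A = W *m diag_mx (\row_(k < n) (s`_k)%:C) *m W^t*.
Proof.
move=> /hermitian_diagonalization [P [d [Pu AE cA]]] [_ cs].
have : perm_eq [tuple d k | k < n] s.
  apply: (perm_map_inj (@complexI R)); apply: prod_XsubC_eq.
  by rewrite [RHS]big_map -cs cA big_map /= big_map big_enum.
rewrite perm_sym => /tuple_permP [p sE].
have perm_unitary : perm_mx p \is @unitarymx R[i] n n.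
  by apply/unitarymxP; rewrite tr_perm_mx map_perm_mx /= -perm_mxM mulgV perm_mx1.
exists ((row_perm p P)^t*).
  by rewrite trmxC_unitary row_permE mul_unitarymx.
rewrite trmxCK AE; apply/matrixP => i j; rewrite !mul_mx_diag !mxE.
rewrite (reindex_inj (@perm_inj _ p)); apply: eq_bigr => k _; rewrite !mxE.
by rewrite sE (nth_map k) ?size_enum_ord // nth_ord_enum tnth_mktuple.
Qed.

Lemma psd_unitary_diag_ge0 (R : realType) n (W : 'M[R[i]]_n) (d : 'rV[R[i]]_n) k :
  W \is unitarymx -> psdmx (W *m diag_mx d *m W^t*) -> 0 <= d 0 k.
Proof.
move=> Wu [_ /(_ (W *m delta_mx k 0))].
have WW := mulmx_adj_unitary Wu.
rewrite trmx_mul map_mxM !mulmxA -(mulmxA _ (W^t*) W) WW mulmx1 -(mulmxA _ (W^t*) W) WW mulmx1.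
rewrite mul_mx_diag mxE (bigD1 k) //= big1 ?addr0 => [|i /negbTE ik]; last first.
  by rewrite !mxE ik mulr0.
by rewrite !mxE !eqxx rmorph1 mul1r mulr1.
Qed.

Lemma tr_unitary_conj (C : numClosedFieldType) n (W D : 'M[C]_n) :
  W \is unitarymx -> \tr (W *m D *m W^t*) = \tr D.
Proof.
by move=> Wu; rewrite mxtrace_mulC mulmxA mulmx_adj_unitary // mul1mx.
Qed.

Lemma purity_unitary_diag (R : realType) n (W : 'M[R[i]]_n) (d : 'rV[R[i]]_n) :
  W \is unitarymx -> purity (W *m diag_mx d *m W^t*) = \sum_k d 0 k ^+ 2.
Proof.
move=> Wu; have WW := mulmx_adj_unitary Wu.
rewrite /purity !mulmxA -(mulmxA _ (W^t*) W) WW mulmx1 -(mulmxA W) tr_unitary_conj //.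
by rewrite mulmx_diag mxtrace_diag; apply: eq_bigr => k _; rewrite mxE expr2.
Qed.

Lemma hermitian_entry (C : numClosedFieldType) n (A : 'M[C]_n) :
  A \is hermsymmx -> forall i j, A j i = Num.conj (A i j).
Proof.
move=> /is_hermitianmxP; rewrite expr0 scale1r => /matrixP hA i j.
by rewrite {1}hA !mxE.
Qed.

(** * Positive 2x2 matrices and the partial transpose *)

Lemma psd2_minor (R : realType) (A : 'M[R[i]]_2) :
  psdmx A ->
  [/\ A 0 0 = (Re (A 0 0))%:C, A 1 1 = (Re (A 1 1))%:C, 0 <= Re (A 0 0),
      0 <= Re (A 1 1)
    & Re (A 0 1) ^+ 2 + Im (A 0 1) ^+ 2 <= Re (A 0 0) * Re (A 1 1)].
Proof.
case=> /hermitian_entry hA psdA; have A10 := hA 0 1.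
have form v0 v1 : 0 <= Re (Num.conj v0 * (A 0 0 * v0 + A 0 1 * v1)
    + Num.conj v1 * (A 1 0 * v0 + A 1 1 * v1)).
  have := psdA (\col_i if i == 0 then v0 else v1).
  rewrite -mulmxA mxE !big_ord_recl big_ord0 !mxE !big_ord_recl !big_ord0 !mxE /= !addr0.
  have -> : lift ord0 ord0 = 1 :> 'I_2 by apply: val_inj.
  by rewrite lecE => /andP[_].
have real_diag k : A k k = (Re (A k k))%:C.
  have := hA k k.
  case: (A k k) => a b [] eqb; congr (_ +i* _).
  by lra.
split=> //.
- have := form 1 0; rewrite rmorph1 rmorph0 !complex_reim /=; lra.
- have := form 0 1; rewrite rmorph1 rmorph0 !complex_reim /=; lra.
rewrite A10 (real_diag 0) (real_diag 1) in form *.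
move: form; move: (Re (A 0 0)) (Re (A 1 1)) (A 0 1) => a c [x y] form /=.
have formR p q s t : 0 <= a * (p ^+ 2 + q ^+ 2) + c * (s ^+ 2 + t ^+ 2)
    + 2 * (x * (p * s + q * t) - y * (p * t - q * s)).
  by have := form (p +i* q) (s +i* t); rewrite !complex_reim /=; lra.
have a0 : 0 <= a by have := formR 1 0 0 0; lra.
have c0 : 0 <= c by have := formR 0 0 1 0; lra.
(* With b = x + i y, the vectors (-conj b, a) and (c, -conj b) need care with conjugation only: the
   two tests below give a (a c - |b|^2) and c (a c - |b|^2), which forces a = c = 0, and the last
   test then gives -2 |b|^2 < 0. *)
rewrite leNgt; apply/negP => lt_ac.
have a_eq0 : a = 0.
  apply/eqP; rewrite eq_le a0 andbT leNgt; apply/negP => a_gt0.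
  have := formR (- x) (- y) a 0.
  by have : 0 < a * (x ^+ 2 + y ^+ 2 - a * c) by [rewrite mulr_gt0 // subr_gt0]; lra.
have c_eq0 : c = 0.
  apply/eqP; rewrite eq_le c0 andbT leNgt; apply/negP => c_gt0.
  have := formR c 0 (- x) y.
  by have : 0 < c * (x ^+ 2 + y ^+ 2 - a * c) by [rewrite mulr_gt0 // subr_gt0]; lra.
have := formR (- x) (- y) 1 0; rewrite a_eq0 c_eq0 in lt_ac *.
by lra.
Qed.

(** A sum of positive semidefinite matrices with rows (P, T) and (T, Q) has nonnegative
    determinant. *)
Lemma sqr_sum_le_mul (R : realType) k (P Q T : 'I_k -> R) :
  (forall i, 0 <= P i) -> (forall i, 0 <= Q i) ->
  (forall i, T i ^+ 2 <= P i * Q i) ->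
  (\sum_i T i) ^+ 2 <= (\sum_i P i) * (\sum_i Q i).
Proof.
elim: k P Q T => [|k IH] P Q T P0 Q0 TPQ.
  by rewrite !big_ord0 expr2 mul0r.
rewrite !big_ord_recr /=.
have := IH (P \o widen_ord (leqnSn k)) (Q \o widen_ord (leqnSn k)) (T \o widen_ord (leqnSn k)).
move=> /(_ (fun=> P0 _) (fun=> Q0 _) (fun=> TPQ _)) /=.
have : 0 <= \sum_(i < k) P (widen_ord (leqnSn k) i) by apply: sumr_ge0.
have : 0 <= \sum_(i < k) Q (widen_ord (leqnSn k) i) by apply: sumr_ge0.
have := P0 ord_max; have := Q0 ord_max; have := TPQ ord_max.
move: (P ord_max) (Q ord_max) (T ord_max) (\sum_(i < k) P _) (\sum_(i < k) Q _)
  (\sum_(i < k) T _) => p q t p' q' t' htpq q0 p0 q0' p0' htpq'.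
have tt : 2 * (t' * t) <= p' * q + p * q'.
  apply: le_trans (ler_norm _) _.
  rewrite -(@ler_pXn2r _ 2) ?nnegrE ?normr_ge0 ?addr_ge0 ?mulr_ge0 //.
  rewrite real_normK ?num_real //.
  have : (t' ^+ 2) * (t ^+ 2) <= (p' * q') * (p * q) by rewrite ler_pM ?sqr_ge0.
  by have := sqr_ge0 (p' * q - p * q'); lra.
by lra.
Qed.

Local Notation e i j := (@mxtens_index 2 2 (i, j)).

(* Positivity of the partial transpose on the span of |00> and |11>. *)
Lemma separable_minor (R : realType) (A : 'M[R[i]]_(2 * 2)) :
  separable A ->
  Re (A (e 0 1) (e 1 0)) ^+ 2 <= Re (A (e 0 0) (e 0 0)) * Re (A (e 1 1) (e 1 1)).
Proof.
move=> [k [p [a [b [p0 _ da db ->]]]]].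
have entry i j i' j' : Re ((\sum_(l < k) (p l)%:C *: (a l *t b l)) (e i j) (e i' j'))
    = \sum_(l < k) p l * Re (a l i i' * b l j j').
  rewrite summxE.
  have ReD : {morph (fun z : R[i] => Re z) : z w / z + w} by move=> z w; rewrite complex_reim.
  rewrite (@big_morph _ _ (fun z : R[i] => Re z) 0 +%R 0 +%R ReD (erefl _)); apply: eq_bigr => l _.
  rewrite mxE tensmxE; move: (a l _ _ * _) => z.
  by rewrite complex_reim /= mul0r subr0.
rewrite !entry; apply: sqr_sum_le_mul => l.
- have [[/psd2_minor [-> _ h _ _] _] [/psd2_minor [-> _ h' _ _] _]] := (da l, db l).
  by rewrite complex_reim /= mulr0 subr0 !mulr_ge0.
- have [[/psd2_minor [_ -> _ h _] _] [/psd2_minor [_ -> _ h' _] _]] := (da l, db l).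
  by rewrite complex_reim /= mulr0 subr0 !mulr_ge0.
have [[hB _] _] := db l.
have [/psd2_minor [-> -> a0 a1 ha] _] := da l.
have [/psd2_minor [-> -> b0 b1 hb] _] := db l.
(* The entry is Re (a01 conj(b01)) = x x' + y y', whose square is |a01|^2 |b01|^2 - (x y' - y
   x')^2. *)
rewrite (hermitian_entry hB 0 1) !complex_reim /=.
move: (a l 0 1) (b l 0 1) ha hb => [x y] [x' y'] /= ha hb.
move: (Re (a l 0 0)) (Re (a l 1 1)) (Re (b l 0 0)) (Re (b l 1 1)) ha hb => al ga be de ha hb.
have : (x ^+ 2 + y ^+ 2) * (x' ^+ 2 + y' ^+ 2) <= (al * ga) * (be * de).
  by rewrite ler_pM // addr_ge0 ?sqr_ge0.
have := sqr_ge0 (x * y' - y * x') => h1 h2.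
have : p l ^+ 2 * (x * x' + y * y') ^+ 2 <= p l ^+ 2 * (al * ga * (be * de)).
  by rewrite ler_wpM2l ?sqr_ge0 //; lra.
by lra.
Qed.

(** * Necessary conditions on the spectrum *)

Lemma absolutely_separable_spectrum (R : realType) (W : 'M[R[i]]_(2 * 2)) (l1 l2 l3 l4 : R) :
  W \is unitarymx ->
  @absolutely_separable R 2 2
    (W *m diag_mx (\row_(k < 4) ([:: l1; l2; l3; l4]`_k)%:C) *m W^t*) ->
  (l1 - l3) ^+ 2 <= 4 * l2 * l4.
Proof.
move=> Wu [_]; pose s : R := (Num.sqrt 2)^-1.
have s2 : s ^+ 2 = 2^-1 by rewrite exprVn sqr_sqrtr.
(* The eigenbasis |01> + |10>, |00>, |01> - |10>, |11> makes the partial transpose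
   restricted to |00>, |11> equal to [[l2, (l1 - l3) / 2], [(l1 - l3) / 2, l4]]. *)
pose V0 : 'M[R]_(2 * 2) := \matrix_(i, j)
  (nth [::] [:: [:: 0; 1; 0; 0]; [:: s; 0; s; 0]; [:: s; 0; - s; 0]; [:: 0; 0; 0; 1]] i)`_j.
pose V : 'M[R[i]]_(2 * 2) := map_mx (real_complex R) V0.
have V0V0 : V0 *m V0^T = 1%:M.
  apply/matrixP => i j; rewrite !mxE !big_ord_recl big_ord0 !mxE.
  by case: i => [[|[|[|[|//]]]] hi]; case: j => [[|[|[|[|//]]]] hj] /=; lra.
have VtE : V^t* = map_mx (real_complex R) V0^T.
  by apply/matrixP => i j; rewrite !mxE; apply: complex_ext; rewrite !complex_reim /= ?oppr0.
have Vu : V \is unitarymx.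
  by apply/unitarymxP; rewrite VtE -map_mxM V0V0 map_mx1.
have [U Uu] := unitary_change_basis
  (diag_mx (\row_(k < 4) ([:: l1; l2; l3; l4]`_k)%:C)) Vu Wu.
move=> UE /(_ U Uu); rewrite UE.
have -> : diag_mx (\row_(k < 4) ([:: l1; l2; l3; l4]`_k)%:C) =
    map_mx (real_complex R) (diag_mx (\row_(k < 4) [:: l1; l2; l3; l4]`_k)).
  by rewrite map_diag_mx; congr diag_mx; apply/rowP => k; rewrite !mxE.
rewrite VtE -!map_mxM => /separable_minor.
rewrite mul_mx_diag !mxE /= !big_ord_recl !big_ord0 !mxE /=.
have -> : s * l1 * s + (0 * l2 * 0 + (s * l3 * - s + (0 * l4 * 0 + 0))) =
  s ^+ 2 * (l1 - l3) by ring.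
by rewrite s2; lra.
Qed.

Lemma absolutely_separable_eigenvalues (R : realType) (rho : 'M[R[i]]_(2 * 2))
    (l1 l2 l3 l4 : R) :
  @absolutely_separable R 2 2 rho -> spectrum_is rho [:: l1; l2; l3; l4] ->
  [/\ [/\ l2 <= l1, l3 <= l2, l4 <= l3 & 0 <= l4], l1 + l2 + l3 + l4 = 1,
      (l1 - l3) ^+ 2 <= 4 * l2 * l4
    & purity rho = (l1 ^+ 2 + l2 ^+ 2 + l3 ^+ 2 + l4 ^+ 2)%:C].
Proof.
move=> as_rho spec_rho; have [[psd_rho tr_rho] _] := as_rho.
have [W Wu rhoE] := unitary_diag_of_spectrum psd_rho.1 spec_rho.
have [/= /and4P[h21 h32 h43 _] _] := spec_rho.
rewrite rhoE in as_rho psd_rho tr_rho *; split.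
- split=> //; have := psd_unitary_diag_ge0 (@ord_max 3) Wu psd_rho.
  by rewrite mxE /= ler0c.
- move: tr_rho; rewrite tr_unitary_conj // mxtrace_diag.
  rewrite !big_ord_recl big_ord0 !mxE /= addr0 -!rmorphD => /(@complexI R).
  by rewrite !addrA.
- exact: absolutely_separable_spectrum Wu as_rho.
rewrite purity_unitary_diag // !big_ord_recl big_ord0 !mxE /= addr0.
by rewrite -!rmorphXn -!rmorphD !addrA.
Qed.

(** * Absolute separability of the extremal state *)

Lemma density_diag (R : realType) n (d : 'I_n -> R) :
  (forall k, 0 <= d k) -> \sum_k d k = 1 ->
  density (diag_mx (\row_(k < n) (d k)%:C)).
Proof.
move=> d0 d1; split; last first.
  rewrite mxtrace_diag; under eq_bigr do rewrite mxE.
  by rewrite -rmorph_sum d1.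
split.
  apply/is_hermitianmxP; rewrite expr0 scale1r tr_diag_mx map_diag_mx.
  by congr diag_mx; apply/rowP => k; rewrite !mxE; apply: complex_ext; rewrite /= ?oppr0.
move=> v; rewrite mul_mx_diag mxE; apply: sumr_ge0 => k _.
by rewrite !mxE mulrAC mulr_ge0 ?ler0c // mulrC mul_conjC_ge0.
Qed.

(** The two eigenvalues differ by r / 2, so conjugation by U gives (1 - r) / 4 times the identity
    plus r / 2 times the projection onto the first two columns of U. *)
Lemma absolutely_separable_extremal (R : realType) :
  let r : R := (Num.sqrt 2)^-1 in
  @absolutely_separable R 2 2
    (diag_mx (\row_(k < 4) (if (k < 2)%N then (1 + r) / 4 else (1 - r) / 4)%:C)).
Proof.
move=> r.
have r_ge0 : 0 <= r by rewrite invr_ge0 sqrtr_ge0.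
have r2 : r ^+ 2 = 2^-1 by rewrite exprVn sqr_sqrtr.
have r_le1 : r <= 1 by rewrite -(@ler_pXn2r _ 2) ?nnegrE // r2 expr1n; lra.
split.
  apply: (@density_diag R 4) => [k|]; first by case: ifP => _; lra.
  by rewrite !big_ord_recl big_ord0 /=; lra.
move=> U Uu.
have UU i j : \sum_k U i k * Num.conj (U j k) = (i == j)%:R.
  have /unitarymxP/matrixP/(_ i j) := Uu; rewrite !mxE => <-.
  by apply: eq_bigr => k _; rewrite !mxE.
have cols j j' : \sum_k U k j * Num.conj (U k j') = (j == j')%:R.
  have /matrixP/(_ j' j) := mulmx_adj_unitary Uu; rewrite !mxE eq_sym => <-.
  by apply: eq_bigr => k _; rewrite !mxE mulrC.
have := @separable_rank2_mixture R (fun k => U k 0) (fun k => U k 1).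
rewrite !cols /= => /(_ erefl erefl erefl erefl).
(* The identity matrix is expanded as U U^* so that both sides are sums over the columns of U. *)
congr separable; apply/matrixP => i j; rewrite -/r mul_mx_diag !mxE -UU.
rewrite !big_ord_recl !big_ord0 !mxE /=.
have -> : lift ord0 ord0 = 1 :> 'I_(2 * 2) by apply: val_inj.
have -> : ord0 = 0 :> 'I_(2 * 2) by apply: val_inj.
have -> : ((1 + r) / 4)%:C = ((1 - r) / 4)%:C + (r / 2)%:C :> R[i].
  by rewrite -rmorphD; congr (_%:C); field.
move: (Num.conj _) (Num.conj _) (Num.conj _) (Num.conj _) (_%:C) (_%:C) => *.
by ring.
Qed.

Theorem theorem3p1 (R : realType) :
  [/\ exists rho : 'M[R[i]]_(2 * 2),
        @absolutely_separable R 2 2 rho /\ purity rho = (3 / 8)%:C,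
      forall rho : 'M[R[i]]_(2 * 2),
        @absolutely_separable R 2 2 rho -> purity rho <= (3 / 8)%:C
    & forall (rho : 'M[R[i]]_(2 * 2)) (l1 l2 l3 l4 : R),
        @absolutely_separable R 2 2 rho ->
        spectrum_is rho [:: l1; l2; l3; l4] ->
        (purity rho = (3 / 8)%:C <->
         [/\ l1 = 1 / 4 + 1 / (4 * Num.sqrt 2),
             l2 = 1 / 4 + 1 / (4 * Num.sqrt 2),
             l3 = 1 / 4 - 1 / (4 * Num.sqrt 2)
           & l4 = 1 / 4 - 1 / (4 * Num.sqrt 2)])].
Proof.
have s2_gt0 : 0 < Num.sqrt 2 :> R by rewrite sqrtr_gt0.
have extremal (l1 l2 l3 l4 : R) :
    [/\ l1 = 1 / 4 + 1 / (4 * Num.sqrt 2), l2 = 1 / 4 + 1 / (4 * Num.sqrt 2),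
        l3 = 1 / 4 - 1 / (4 * Num.sqrt 2) & l4 = 1 / 4 - 1 / (4 * Num.sqrt 2)] ->
    l1 ^+ 2 + l2 ^+ 2 + l3 ^+ 2 + l4 ^+ 2 = 3 / 8.
  (* The sum of squares is 1/4 + 4 t^2. *)
  move=> [-> -> -> ->]; pose t : R := 1 / (4 * Num.sqrt 2); rewrite -/t.
  have t2 : t ^+ 2 = 1 / 32.
    by rewrite expr_div_n expr1n exprMn sqr_sqrtr //; field.
  by lra.
split.
- exists (diag_mx (\row_(k < 4)
    (if (k < 2)%N then (1 + (Num.sqrt 2)^-1) / 4 else (1 - (Num.sqrt 2)^-1) / 4)%:C)).
  split; first exact: absolutely_separable_extremal.
  (* The state is already diagonal, so the identity serves as the unitary eigenbasis. *)
  have := purity_unitary_diag (\row_(k < 4)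
    (if (k < 2)%N then (1 + (Num.sqrt 2)^-1) / 4 else (1 - (Num.sqrt 2)^-1) / 4 : R)%:C)
    (_ : 1%:M \is unitarymx).
  rewrite trmx1 map_mx1 mul1mx mulmx1 => ->; last first.
    by apply/unitarymxP; rewrite trmx1 map_mx1 mulmx1.
  rewrite !big_ord_recl big_ord0 !mxE /= addr0 -!rmorphXn -!rmorphD !addrA.
  by congr (_%:C); apply: extremal; split; field; rewrite gt_eqF.
- move=> rho as_rho.
  have [s spec_rho] := hermitian_spectrum as_rho.1.1.1.
  case: s spec_rho => -[|l1 [|l2 [|l3 [|l4 [|//]]]]] //= _ spec_rho.
  have [[h21 h32 h43 h4] sum1 hc ->] := absolutely_separable_eigenvalues as_rho spec_rho.
  by rewrite lecR; have [] := sqr_sum_le h21 h32 h43 h4 sum1 hc.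
move=> rho l1 l2 l3 l4 as_rho spec_rho.
have [[h21 h32 h43 h4] sum1 hc ->] := absolutely_separable_eigenvalues as_rho spec_rho.
have [_ eq_case] := sqr_sum_le h21 h32 h43 h4 sum1 hc.
by split=> [/(@complexI R)/eq_case|/extremal ->].
Qed.
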